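(* For every integer $n\ge 1$, $$\mathrm{RB}_n(112)=\mathrm{LS}_n(122)=\sum_{m=0}^{n}\binom{n-1}{n-m}q^{\binom{m}{2}}.$$
   Context: A restricted growth function (RGF) of length $n$ is a sequence $w=w_1\dots w_n$ of positive integers with $w_1=1$ and $w_i\le 1+\max\{w_1,\dots,w_{i-1}\}$ for $i\ge 2$; $R_n$ is the set of RGFs of length $n$. The standardization of a word replaces every occurrence of its smallest letter by $1$, of its next smallest letter by $2$, and so on. An RGF $w$ contains an RGF $v$ if some subword (subsequence, not necessarily consecutive) of $w$ standardizes to $v$; otherwise $w$ avoids $v$. $R_n(v)$ is the set of $w\in R_n$ avoiding $v$. For a word $w$ and position $j$: $\mathrm{ls}(w_j)$ is the number of distinct values $w_i$ with $i<j$ and $w_i<w_j$; $\mathrm{rb}(w_j)$ is the number of distinct values $w_i$ with $i>j$ and $w_i>w_j$; $\mathrm{ls}(w)=\sum_j\mathrm{ls}(w_j)$, $\mathrm{rb}(w)=\sum_j\mathrm{rb}(w_j)$. Then $\mathrm{LS}_n(v)=\sum_{w\in R_n(v)}q^{\mathrm{ls}(w)}$ and $\mathrm{RB}_n(v)=\sum_{w\in R_n(v)}q^{\mathrm{rb}(w)}$. Binomial coefficients $\binom{a}{b}$ are $0$ when $b<0$ or $b>a\ge 0$. *)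

(* Defs.v *)
From mathcomp Require Import all_boot all_order all_algebra.

Set Implicit Arguments.
Unset Strict Implicit.
Unset Printing Implicit Defensive.

Import GRing.Theory.

(* Words are sequences of natural numbers; positions are 0-based, so that the
   letter written w_j in the usual notation is nth 0 w (j - 1). *)

Definition is_rgf (w : seq nat) : bool :=
  [&& all (fun x => 0 < x) w,
      head 1 w == 1
    & all (fun i => nth 0 w i <= 1 + \max_(x <- take i w) x)
          (iota 1 (size w).-1)].

Definition standardize (w : seq nat) : seq nat :=
  [seq (index x (sort leq (undup w))).+1 | x <- w].

Definition contains (w v : seq nat) : bool :=
  [exists m : (size w).-tuple bool, standardize (mask m w) == v].

Definition avoids (w v : seq nat) : bool := ~~ contains w v.

Definition ls_at (w : seq nat) (j : nat) : nat :=
  size (undup [seq x <- take j w | x < nth 0 w j]).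

Definition rb_at (w : seq nat) (j : nat) : nat :=
  size (undup [seq x <- drop j.+1 w | nth 0 w j < x]).

Definition ls (w : seq nat) : nat := \sum_(j < size w) ls_at w j.

Definition rb (w : seq nat) : nat := \sum_(j < size w) rb_at w j.

(* The letters of an RGF of length n are at most n, so the finite type
   n.-tuple 'I_n.+1 holds every RGF of length n; see rgf_tupleP below. *)
Definition word n (t : n.-tuple 'I_n.+1) : seq nat := map val t.

Definition Rset (n : nat) : {set n.-tuple 'I_n.+1} :=
  [set t | is_rgf (word t)].

Definition Ravoid (n : nat) (v : seq nat) : {set n.-tuple 'I_n.+1} :=
  [set t in Rset n | avoids (word t) v].

Definition LS (n : nat) (v : seq nat) : {poly int} :=
  (\sum_(t in Ravoid n v) 'X^(ls (word t)))%R.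

Definition RB (n : nat) (v : seq nat) : {poly int} :=
  (\sum_(t in Ravoid n v) 'X^(rb (word t)))%R.

Lemma rgf_nth_le w i : is_rgf w -> i < size w -> nth 0 w i <= i.+1.
Proof.
case/and3P=> _ /eqP h0 /allP hmax.
elim/ltn_ind: i => -[|i] IH lti; first by case: w h0 lti {hmax IH} => //= x s ->.
have /hmax /leq_trans-> // : i.+1 \in iota 1 (size w).-1.
  by rewrite mem_iota add1n prednK // (leq_ltn_trans _ lti).
rewrite add1n ltnS big_seq; elim/big_rec: _ => // x m /(nthP 0)[k].
rewrite size_take lti => ltk <- le_m; rewrite nth_take // geq_max le_m andbT.
by rewrite (leq_trans (IH k ltk (ltn_trans ltk lti))).
Qed.

Lemma rgf_tupleP n (w : seq nat) :
  size w = n /\ is_rgf w <-> exists2 t, t \in Rset n & word t = w.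
Proof.
split=> [[sz rgfw]|[t]]; last by rewrite inE => rgft <-; rewrite size_map size_tuple.
have szt : size (map (@inord n) w) == n by rewrite size_map sz.
have wt : word (Tuple szt) = w.
  rewrite /word /= -map_comp -[RHS]map_id; apply/eq_in_map => x /(nthP 0)[i lti <-].
  by rewrite /= inordK // ltnS (leq_trans (rgf_nth_le rgfw lti)) // -sz.
by exists (Tuple szt); rewrite ?inE wt.
Qed.

Lemma word_inj n : injective (@word n).
Proof. by move=> t u /(inj_map val_inj) /val_inj. Qed.

(* Main.v *)
(** An RGF with maximum [m] avoids 112 iff it is [1 2 ... m] followed by a
    weakly decreasing word on [1..m]: only the initial run contributes to [rb],
    giving [C(m, 2)], and there are [C(n-1, n-m)] such words.  It avoids 122 iff
    each letter other than 1 occurs once, that is, iff every position after the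
    first carries either 1 or a new maximum: the new maxima contribute
    [1 + ... + (m-1)] to [ls], and choosing their positions gives the same
    count. *)

Require Import Defs.
From mathcomp Require Import all_boot all_order all_algebra.
From mathcomp Require Import zify.

(** * Standardization and pattern containment *)

Lemma leq_index_sort (w : seq nat) x y : x \in w -> y \in w ->
  (index x (sort leq (undup w)) <= index y (sort leq (undup w))) = (x <= y).
Proof.
set s := sort _ _ => xw yw.
have ss : sorted leq s by apply/sort_sorted/leq_total.
have [xs ys] : x \in s /\ y \in s by rewrite !mem_sort !mem_undup.
have leP := sorted_leq_index leq_trans leqnn ss.
apply/idP/idP => [|le_xy]; first exact: leP.
case: leqP => // lt_yx; have le_yx := leP _ _ ys xs (ltnW lt_yx).
by move: lt_yx; rewrite (@anti_leq x y) ?le_xy ?ltnn.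
Qed.

(** Positions in the sorted list of letters compare as the letters do, so the equalities and
    inequalities of the pattern pull back to [w]. *)
Lemma standardize112 (w : seq nat) :
  reflect (exists a b, a < b /\ w = [:: a; a; b]) (standardize w == [:: 1; 1; 2]).
Proof.
apply: (iffP eqP) => [|[a [b [lt_ab ->]]]].
  case: w => [|a [|c [|b [|]]]] //; rewrite /standardize !map_cons.
  set s := sort _ _ => -[ia ic ib].
  have leE := @leq_index_sort [:: a; c; b].
  exists a, b; split.
    by rewrite ltnNge -leE ?inE ?eqxx ?orbT // ia ib.
  suff -> : a = c by [].
  by apply: anti_leq; rewrite -(leE a c) -1?(leE c a) ?inE ?eqxx ?orbT // ia ic.
rewrite /standardize /= !inE eqxx /= (ltn_eqF lt_ab) /sort /= (ltnW lt_ab) /=.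
by rewrite eqxx eqxx (ltn_eqF lt_ab).
Qed.

Lemma standardize122 (w : seq nat) :
  reflect (exists a b, a < b /\ w = [:: a; b; b]) (standardize w == [:: 1; 2; 2]).
Proof.
apply: (iffP eqP) => [|[a [b [lt_ab ->]]]].
  case: w => [|a [|b [|c [|]]]] //; rewrite /standardize !map_cons.
  set s := sort _ _ => -[ia ib ic].
  have leE := @leq_index_sort [:: a; b; c].
  exists a, b; split.
    by rewrite ltnNge -leE ?inE ?eqxx ?orbT // ia ib.
  suff -> : b = c by [].
  by apply: anti_leq; rewrite -(leE b c) -1?(leE c b) ?inE ?eqxx ?orbT // ib ic.
rewrite /standardize /= !inE eqxx /= (ltn_eqF lt_ab) /sort /= (ltnW lt_ab) /=.
by rewrite eqxx eqxx (ltn_eqF lt_ab).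
Qed.

Lemma containsP (w v : seq nat) :
  reflect (exists2 s, subseq s w & standardize s == v) (contains w v).
Proof.
apply: (iffP existsP) => [[m sm]|[s /subseqP[m sz_m ->] sm]].
  by exists (mask m w); rewrite ?mask_subseq.
by move/eqP: sz_m => sz_m; exists (Tuple sz_m).
Qed.

Lemma subseq_nseq (T : eqType) k (x : T) w :
  subseq (nseq k x) w = (k <= count_mem x w).
Proof.
apply/idP/idP => [/(leq_count_subseq (pred1 x))|].
  by rewrite count_nseq /= eqxx mul1n.
elim: w k => [|y w IH] [|k] //=.
rewrite [x == y]eq_sym; case: (y =P x) => _ /=.
  exact: IH.
exact: (IH k.+1).
Qed.

(** Reversal turns the first-letter recursion of [subseq] into one on last letters, which suits
    words grown by appending. *)
Lemma subseq_rcons2 (T : eqType) (s w : seq T) x y :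
  subseq (rcons s x) (rcons w y) = if x == y then subseq s w else subseq (rcons s x) w.
Proof.
rewrite -subseq_rev !rev_rcons /=; case: eqP => _; first by rewrite subseq_rev.
by rewrite -rev_rcons subseq_rev.
Qed.

(** A copy of 112 that uses the appended letter must use it as its final 2, after two equal smaller
    letters. *)
Lemma avoids112_rcons (w : seq nat) x :
  avoids (rcons w x) [:: 1; 1; 2] <->
  avoids w [:: 1; 1; 2] /\ (forall a, a < x -> count_mem a w <= 1).
Proof.
split=> [/containsP av|[/containsP av cnt]].
  split=> [|a lt_ax].
    apply/containsP => -[s sw std]; apply: av; exists s => //.
    exact: subseq_trans sw (subseq_rcons _ _).
  rewrite leqNgt -subseq_nseq; apply/negP => sub.
  apply: av; exists (rcons (nseq 2 a) x); first by rewrite subseq_rcons2 eqxx.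
  by apply/standardize112; exists a, x.
apply/containsP => -[s sw /standardize112[a [b [lt_ab es]]]].
move: sw; rewrite es -[[:: a; a; b]]/(rcons (nseq 2 a) b) subseq_rcons2.
case: eqP => [eb|_ sw]; first by rewrite subseq_nseq ltnNge cnt -?eb.
apply: av; exists [:: a; a; b] => //; apply/standardize112.
by exists a, b.
Qed.

(** * Maxima, and growing an RGF by one letter *)

Definition wmax (w : seq nat) := \max_(x <- w) x.

Lemma wmax_rcons w x : wmax (rcons w x) = maxn (wmax w) x.
Proof. by rewrite /wmax -cats1 big_cat big_seq1. Qed.

Lemma leq_wmax w x : x \in w -> x <= wmax w.
Proof. by move=> xw; apply: (@leq_bigmax_seq _ w predT id). Qed.

(** The case of empty [w] fits too: [head 1] makes the empty word an RGF and its [wmax] is 0, so the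
    appended letter must be 1. *)
Lemma is_rgf_rcons w x : is_rgf (rcons w x) = is_rgf w && (0 < x <= (wmax w).+1).
Proof.
case: w => [|y w].
  by rewrite /is_rgf /= /wmax big_nil /= andbT; case: x => [|[]].
rewrite /is_rgf all_rcons size_rcons [_.-1]/= [_.-1]/= -[in iota 1 _](addn1 (size w)).
rewrite iotaD all_cat all_seq1 [1 + size w]add1n.
have -> : nth 0 (rcons (y :: w) x) (size w).+1 = x by rewrite nth_rcons ltnn eqxx.
have -> : take (size w).+1 (rcons (y :: w) x) = y :: w.
  by rewrite -cats1 take_cat ltnn subnn cats0.
rewrite add1n (_ : head 1 _ = y) // -/(wmax (y :: w)).
set p := all _ (iota _ _); set q := all _ (iota _ _).
have -> : p = q.
  (* Appending a letter changes neither the letters nor the prefixes at earlier positions. *)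
  apply: eq_in_all => i; rewrite mem_iota add1n => /andP[_ lt_i].
  by rewrite -cats1 nth_cat lt_i take_cat lt_i.
by rewrite (_ : head 1 (y :: w) = y) //; lia.
Qed.

Lemma rgf_gt0 w x : is_rgf w -> x \in w -> 0 < x.
Proof. by case/andP=> /allP gt0_w _ /gt0_w. Qed.

(** Each appended letter raises the maximum by at most one, so no value below it is skipped. *)
Lemma mem_rgf w x : is_rgf w -> (x \in w) = (0 < x <= wmax w).
Proof.
elim/last_ind: w => [|w y IH]; first by rewrite /wmax big_nil; case: x.
rewrite is_rgf_rcons => /andP[/IH w_rgf bounds_y].
by rewrite mem_rcons inE w_rgf wmax_rcons; lia.
Qed.

(** * RGFs avoiding 112 and their [rb] *)

Lemma uniq_count_mem (T : eqType) (s : seq T) x : uniq s -> count_mem x s <= 1.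
Proof. by move/count_uniq_mem->; case: (x \in s). Qed.

Lemma iotaSr k n : iota k n.+1 = rcons (iota k n) (k + n).
Proof. by rewrite -(addn1 n) iotaD cats1. Qed.

Lemma wmax_iota m : wmax (iota 1 m) = m.
Proof.
elim: m => [|m IH]; first by rewrite /wmax big_nil.
by rewrite iotaSr wmax_rcons IH; lia.
Qed.

Lemma wmax_iota_cat m d : all (fun x => x <= m) d -> wmax (iota 1 m ++ d) = m.
Proof.
elim/last_ind: d => [|d x IH]; first by rewrite cats0 wmax_iota.
rewrite all_rcons => /andP[le_xm /IH wm].
by rewrite -rcons_cat wmax_rcons wm; lia.
Qed.

Lemma sorted_geq_rcons d x :
  sorted geq (rcons d x) = all (geq^~ x) d && sorted geq d.
Proof.
have geq_trans : transitive geq by move=> a b c /=; lia.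
by rewrite !(sorted_pairwise geq_trans) pairwise_rcons.
Qed.

Lemma rgf_avoids112 w :
  is_rgf w /\ avoids w [:: 1; 1; 2] <->
  exists m d, [/\ all (fun x => 0 < x <= m) d, sorted geq d & w = iota 1 m ++ d].
Proof.
split=> [|[m [d [bounds_d sorted_d ->]]]].
  elim/last_ind: w => [|w x IH]; first by exists 0, [::].
  rewrite is_rgf_rcons avoids112_rcons => -[/andP[w_rgf bounds_x] [w_av cnt]].
  have [m [d [bounds_d sorted_d ew]]] := IH (conj w_rgf w_av).
  have wm : wmax w = m.
    by rewrite ew wmax_iota_cat //; apply: sub_all bounds_d => a /andP[].
  move: bounds_x; rewrite wm => bounds_x.
  (* With an empty tail, [x] either repeats a letter of the run and starts the tail, or is [m.+1]
     and extends the run. *)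
  have [/eqP d0|d_neq0] := boolP (d == [::]).
    have [ltx|gtx] := leqP x m.
      by exists m, [:: x]; rewrite ew d0 cats0 cats1 /= andbT; split => //; lia.
    exists m.+1, [::]; split => //; rewrite cats0 iotaSr ew d0 cats0.
    by congr rcons; lia.
  (* A letter of [d] also occurs in the run, hence at least twice in [w], so a larger [x] would
     complete a 112. *)
  have le_xd a : a \in d -> x <= a.
    move=> a_d; rewrite leqNgt; apply/negP => /cnt.
    rewrite ew count_cat count_uniq_mem ?iota_uniq // mem_iota.
    have /allP/(_ _ a_d) := bounds_d.
    by move: a_d; rewrite -has_pred1 has_count; lia.
  (* Any such [a] gives [x <= a <= m], the upper bound required of the new tail letter. *)
  have [a a_d] : exists a, a \in d.
    case: d d_neq0 {ew bounds_d sorted_d le_xd} => // a d _.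
    by exists a; rewrite mem_head.
  exists m, (rcons d x); rewrite all_rcons sorted_geq_rcons ew rcons_cat.
  rewrite sorted_d bounds_d !andbT; split => //; last by apply/allP => b /le_xd.
  by have /allP/(_ _ a_d) := bounds_d; have := le_xd _ a_d; lia.
elim/last_ind: d bounds_d sorted_d => [_ _|d x IH].
  rewrite cats0; elim: m => [|m [IHr IHa]].
    by split=> //; apply/containsP => -[s]; rewrite subseq0 => /eqP->.
  rewrite iotaSr is_rgf_rcons avoids112_rcons wmax_iota IHr.
  split; first by lia.
  by split=> // a _; rewrite uniq_count_mem ?iota_uniq.
rewrite all_rcons sorted_geq_rcons -rcons_cat => /andP[bounds_x bounds_d].
case/andP=> le_xd /(IH bounds_d)[IHr IHa].
rewrite is_rgf_rcons avoids112_rcons IHr wmax_iota_cat; last first.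
  by apply: sub_all bounds_d => a /andP[].
split; first by lia.
(* The tail has no letter below [x], so [a] can occur only in the run, and at most once. *)
split=> // a lt_ax; rewrite count_cat (_ : count_mem a d = 0) ?addn0.
  by rewrite uniq_count_mem ?iota_uniq.
by apply/count_memPn/negP => /(allP le_xd) /=; lia.
Qed.

Lemma rb_cons x w : rb (x :: w) = size (undup [seq y <- w | x < y]) + rb w.
Proof. by rewrite /rb /= big_ord_recl /rb_at /= drop0. Qed.

Lemma rb_sorted d : sorted geq d -> rb d = 0.
Proof.
elim: d => [|x d IH]; first by rewrite /rb big_ord0.
have geq_trans : transitive geq by move=> a b c /=; lia.
rewrite (sorted_pairwise geq_trans) /= -(sorted_pairwise geq_trans).
case/andP=> le_d /IH; rewrite rb_cons => ->.
rewrite (_ : filter _ d = [::]) //.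
apply/eqP; rewrite -[_ == _]negbK -has_filter -all_predC.
by apply: sub_all le_d => y /=; lia.
Qed.

(** The run starts at an arbitrary [k.+1] so that the induction can remove its first letter. The
    larger values to the right of that letter are exactly the rest of the run, since the tail adds
    none above [k + p]. *)
Lemma rb_iota_cat k p d : all (fun x => x <= k + p) d -> sorted geq d ->
  rb (iota k.+1 p ++ d) = 'C(p, 2).
Proof.
move=> bounds_d sorted_d; elim: p k bounds_d => [|p IH] k bounds_d.
  by rewrite rb_sorted.
rewrite [iota _ _]/= cat_cons rb_cons IH; last by rewrite addSnnS.
rewrite binS bin1 addnC; congr (_ + _).
rewrite -[RHS](size_iota k.+2); apply/perm_size/uniq_perm.
- exact: undup_uniq.
- exact: iota_uniq.
move=> x; rewrite mem_undup mem_filter mem_cat !mem_iota.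
have [/(allP bounds_d)|_] := boolP (x \in d); lia.
Qed.

(** * RGFs avoiding 122 and their [ls] *)

Lemma ls_rcons w x : ls (rcons w x) = ls w + size (undup [seq y <- w | y < x]).
Proof.
rewrite /ls size_rcons big_ord_recr /=; congr (_ + _).
  apply: eq_bigr => i _; rewrite /ls_at -cats1 nth_cat take_cat.
  by rewrite ltn_ord.
by rewrite /ls_at -cats1 nth_cat take_cat ltnn subnn cats0.
Qed.

Lemma avoids122_rcons (w : seq nat) x :
  avoids (rcons w x) [:: 1; 2; 2] <->
  avoids w [:: 1; 2; 2] /\ (forall a, a < x -> ~~ subseq [:: a; x] w).
Proof.
split=> [/containsP av|[/containsP av no_ax]].
  split=> [|a lt_ax].
    apply/containsP => -[s sw std]; apply: av; exists s => //.
    exact: subseq_trans sw (subseq_rcons _ _).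
  apply/negP => sub; apply: av; exists (rcons [:: a; x] x).
    by rewrite subseq_rcons2 eqxx.
  by apply/standardize122; exists a, x.
apply/containsP => -[s sw /standardize122[a [b [lt_ab es]]]].
move: sw; rewrite es -[[:: a; b; b]]/(rcons [:: a; b] b) subseq_rcons2.
case: eqP => [eb|_ sw]; first by rewrite eb; apply/negP/no_ax; rewrite -eb.
apply: av; exists [:: a; b; b] => //; apply/standardize122.
by exists a, b.
Qed.

(* [k] is the current maximum: [true] appends a new maximum, [false] a 1. *)
Fixpoint record_word (k : nat) (b : seq bool) : seq nat :=
  if b is c :: b' then
    if c then k.+1 :: record_word k.+1 b' else 1 :: record_word k b'
  else [::].

Lemma record_word_rcons k b c :
  record_word k (rcons b c) =
  rcons (record_word k b) (if c then (k + count id b).+1 else 1).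
Proof.
elim: b k => [|a b IH] k /=; first by rewrite addn0; case: c.
by case: a; rewrite IH //= addSnnS.
Qed.

Lemma size_record_word k b : size (record_word k b) = size b.
Proof. by elim: b k => //= -[] b IH k /=; rewrite IH. Qed.

(** The condition [0 < k] separates the two choices: at [k = 0] both bits write the letter 1. *)
Lemma record_word_inj k : 0 < k -> injective (record_word k).
Proof.
move=> k_gt0 b b'; elim: b b' k k_gt0 => [|a b IH] [|a' b'] k k_gt0 //=.
- by case: a'.
- by case: a.
case: a; case: a' => // -[]; try by move=> e; rewrite (IH _ _ _ e).
- lia.
- lia.
Qed.

Lemma wmax_record_word k b : wmax (record_word k (true :: b)) = k.+1 + count id b.
Proof.
elim/last_ind: b => [|b c IH].
  by rewrite /wmax /= big_seq1 addn0.
rewrite -rcons_cons record_word_rcons wmax_rcons IH -cats1 count_cat /=.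
by case: c => /=; lia.
Qed.

(** The leading [true] writes the forced initial 1, so the free bits [b] are one fewer than the
    letters. *)
Lemma rgf_avoids122 w :
  [/\ is_rgf w, avoids w [:: 1; 2; 2] & w != [::]] <->
  exists b, w = record_word 0 (true :: b).
Proof.
elim/last_ind: w => [|w x IH]; first by split=> [[]|[]].
have [/eqP w0|w_neq0] := boolP (w == [::]).
  rewrite w0; split=> [[]|[[|[] b] // [->]]].
    by rewrite is_rgf_rcons /wmax big_nil => x1 _ _; exists [::] => /=; congr [:: _]; lia.
  split=> //.
  apply/avoids122_rcons; split=> //; apply/containsP => -[s].
  by rewrite subseq0 => /eqP->.
have rgf_mem1 : is_rgf w -> exists u, w = 1 :: u.
  case: w w_neq0 {IH} => // y u _ /and3P[_ /eqP /= -> _].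
  by exists u.
(* As [w] starts with 1, a repeated [x > 1] would complete the pattern as 1, [x], [x]. If [x <= 1],
   no positive letter lies below it. *)
have fresh : is_rgf w ->
    (forall a, a < x -> ~~ subseq [:: a; x] w) <-> (x <= 1) || (x \notin w).
  move=> w_rgf; split=> [no_ax|].
    rewrite leqNgt; have [lt1x|//] := boolP (1 < x).
    have [u ew] := rgf_mem1 w_rgf; have := no_ax 1 lt1x.
    by rewrite ew /= sub1seq inE; case: eqP => // ?; lia.
  move=> x_new a lt_ax; apply/negP => /mem_subseq sub.
  have /sub := mem_head a [:: x]; have /sub : x \in [:: a; x] by rewrite !inE eqxx orbT.
  by move=> xw /(rgf_gt0 _ _ w_rgf); rewrite xw orbF in x_new; lia.
split=> [[]|[b]].
  rewrite is_rgf_rcons => /andP[w_rgf bounds_x] /avoids122_rcons[w_av /(fresh w_rgf)].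
  have [b ew] : exists b, w = record_word 0 (true :: b) by apply/IH.
  (* By [mem_rgf], a letter absent from [w] exceeds its maximum, so growth forces it to be the next
     value. *)
  rewrite mem_rgf // => x_new _; move: bounds_x x_new.
  rewrite ew wmax_record_word => bounds_x x_new.
  exists (rcons b (x != 1)); rewrite -rcons_cons record_word_rcons.
  by congr rcons; case: eqP => [//|x_neq1] /=; lia.
case/lastP: b => [|b c]; first by case: w w_neq0 {IH rgf_mem1 fresh} => // ? [].
rewrite -rcons_cons record_word_rcons => /rcons_inj[ew ex].
have [w_rgf w_av _] : [/\ is_rgf w, avoids w [:: 1; 2; 2] & w != [::]] by apply/IH; exists b.
have wm : wmax w = (count id b).+1 by rewrite ew wmax_record_word.
split; last by rewrite -size_eq0 size_rcons.
  by rewrite is_rgf_rcons w_rgf ex wm; case: c {ex} => /=; lia.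
apply/avoids122_rcons; split=> //; apply/fresh => //; rewrite mem_rgf // wm ex.
by case: c {ex} => /=; lia.
Qed.

Lemma ls_record_word b : ls (record_word 0 (true :: b)) = 'C((count id b).+1, 2).
Proof.
elim/last_ind: b => [|b c IH]; first by rewrite /ls big_ord1.
set w := record_word 0 (true :: b) in IH *.
have [w_rgf _ _] : [/\ is_rgf w, avoids w [:: 1; 2; 2] & w != [::]].
  by apply/rgf_avoids122; exists b.
have mem_w x : (x \in w) = (0 < x <= (count id b).+1).
  by rewrite mem_rgf // wmax_record_word.
rewrite -rcons_cons record_word_rcons -/w ls_rcons IH.
rewrite -cats1 count_cat [count id [:: _]]/= addn0.
rewrite add0n [count id (true :: b)]/= add1n; clearbody w.
case: c => /=; rewrite ?addn1 ?addn0.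
  (* The new maximum sees every value of [w] below it, namely 1 up to [(count id b).+1]. *)
  rewrite [RHS]binS bin1; congr (_ + _).
  rewrite -[RHS](size_iota 1); apply/perm_size/uniq_perm.
  - exact: undup_uniq.
  - exact: iota_uniq.
  by move=> x; rewrite mem_undup mem_filter mem_w mem_iota; lia.
rewrite (_ : filter _ w = [::]) ?addn0 //.
apply/eqP; rewrite -[_ == _]negbK -has_filter -all_predC; apply/allP => x.
by rewrite mem_w /=; lia.
Qed.

(** * Counting the avoiders by their maximum *)

Lemma wmax_word n (t : n.-tuple 'I_n.+1) : wmax (word t) <= n.
Proof. by apply/bigmax_leqP_seq => _ /mapP[i _ ->] _; exact: leq_ord. Qed.

Definition Rmax n v m := [set t in Ravoid n v | wmax (word t) == m].

(** The statistic depends only on the maximum, so the sum is grouped by it; [inord] loses nothing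
    because the maximum is at most [n]. *)
Lemma sum_Ravoid n v (st : seq nat -> nat) :
    {in Ravoid n v, forall t, st (word t) = 'C(wmax (word t), 2)} ->
  (\sum_(t in Ravoid n v) 'X^(st (word t)) =
   \sum_(0 <= m < n.+1) #|Rmax n v m|%:R * 'X^('C(m, 2)) :> {poly int})%R.
Proof.
move=> stE; rewrite big_mkord.
rewrite (partition_big (fun t => inord (wmax (word t)) : 'I_n.+1) predT) //=.
apply: eq_bigr => m _; rewrite (eq_bigr (fun=> 'X^('C(m, 2)))%R).
  rewrite GRing.sumr_const GRing.mulr_natl; congr (_ *+ _)%R.
  apply: eq_card => t; rewrite [in RHS]inE unfold_in /=; congr (_ && _).
  by rewrite -val_eqE /= inordK // ltnS wmax_word.
move=> t /andP[/stE-> /eqP <-].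
by rewrite inordK // ltnS wmax_word.
Qed.

(** Lets the bijections be stated on plain words: [rgf_tupleP] recovers the bounded tuple, and both
    enumerations become duplicate-free lists with the same members. *)
Lemma card_Rmax n v m (T : finType) (A : {set T}) (f : T -> seq nat) :
    {in A &, injective f} ->
    (forall w, [/\ size w = n, is_rgf w, avoids w v & wmax w = m] <->
               exists2 a, a \in A & w = f a) ->
  #|Rmax n v m| = #|A|.
Proof.
move=> f_inj RmaxP.
rewrite !cardE -(size_map (@word n)) -(size_map f (enum A)).
apply/perm_size/uniq_perm.
- by rewrite (map_inj_uniq (@word_inj n)) enum_uniq.
- by rewrite map_inj_in_uniq ?enum_uniq // => a b; rewrite !mem_enum; apply: f_inj.
move=> w; apply/mapP/mapP => [[t]|[a]].
  rewrite mem_enum !inE => /andP[/andP[t_rgf t_av] /eqP t_max] ->.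
  have [|a aA ->] := (RmaxP (word t)).1; last by exists a; rewrite ?mem_enum.
  by rewrite size_map size_tuple.
rewrite mem_enum => aA ew.
have [sz_w w_rgf w_av w_max] : [/\ size w = n, is_rgf w, avoids w v & wmax w = m].
  by apply/RmaxP; exists a.
have [t _ et] := (rgf_tupleP n w).1 (conj sz_w w_rgf).
by exists t; rewrite // mem_enum !inE et w_rgf w_av w_max eqxx.
Qed.

(** Matches the term [m = 0] of the formula, where the binomial is 0. *)
Lemma card_Rmax0 n v : 0 < n -> #|Rmax n v 0| = 0.
Proof.
move=> n_gt0; apply/eqP; rewrite cards_eq0; apply/eqP/setP => t; rewrite !inE.
apply/negP => /andP[/andP[t_rgf _] /eqP t_max].
have : size (word t) = n by rewrite size_map size_tuple.
case: (word t) t_rgf t_max => [_ _ /= n0|x w /= rgf_xw wm _].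
  by rewrite -n0 in n_gt0.
by have := mem_rgf _ x rgf_xw; rewrite mem_head wm; lia.
Qed.

Lemma card_Rmax112 n m : m < n -> #|Rmax n [:: 1; 1; 2] m.+1| = 'C(n.-1, n - m.+1).
Proof.
(* The shape used by [card_sorted_tuples]: tail length plus largest letter of the alphabet 0 to
   [m]. *)
move=> lt_mn; have -> : n.-1 = n - m.+1 + m by lia.
rewrite -card_sorted_tuples.
(* Complementing to [m.+1] turns weakly increasing words on 0 to [m] into weakly decreasing tails on
   1 to [m.+1]. *)
pose f (t : (n - m.+1).-tuple 'I_m.+1) := iota 1 m.+1 ++ [seq m.+1 - val i | i <- t].
apply: (@card_Rmax _ _ _ _ _ f) => [s t _ _ /eqP|w].
  rewrite eqseq_cat // => /andP[_ /eqP/inj_map est].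
  apply/val_inj/est => i j /= eij; apply/val_inj => /=.
  by have := ltn_ord i; have := ltn_ord j; lia.
split=> [[sz_w w_rgf w_av w_max]|[t]].
  have [p [d [bounds_d sorted_d ew]]] := (rgf_avoids112 w).1 (conj w_rgf w_av).
  have ep : p = m.+1.
    by rewrite -w_max ew wmax_iota_cat //; apply: sub_all bounds_d => a /andP[].
  rewrite {}ep in bounds_d ew.
  have sz_d : size [seq inord (m.+1 - x) : 'I_m.+1 | x <- d] == n - m.+1.
    by rewrite size_map -sz_w ew size_cat size_iota; lia.
  exists (Tuple sz_d).
    rewrite inE /= -map_comp sorted_map.
    apply: sub_in_sorted bounds_d sorted_d => x y; rewrite !unfold_in /= => bx by_ le_yx.
    by rewrite !inordK; lia.
  rewrite ew /f /= -map_comp -[in LHS](map_id d); congr (_ :: _ ++ _).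
  apply/eq_in_map => x /(allP bounds_d) bx /=.
  by rewrite inordK; lia.
rewrite inE => sorted_t ->.
have bounds_t : all (fun x => 0 < x <= m.+1) [seq m.+1 - val i | i <- t].
  by apply/allP => _ /mapP[i _ ->] /=; have := ltn_ord i; lia.
have [w_rgf w_av] : is_rgf (f t) /\ avoids (f t) [:: 1; 1; 2].
  apply/rgf_avoids112; exists m.+1, [seq m.+1 - val i | i <- t]; split=> //.
  rewrite sorted_map; move: sorted_t; rewrite sorted_map; apply: sub_sorted => i j /=.
  lia.
split=> //; first by rewrite size_cat size_iota size_map size_tuple; lia.
by rewrite wmax_iota_cat //; apply: sub_all bounds_t => a /andP[].
Qed.

Lemma card_Rmax122 n m : m < n -> #|Rmax n [:: 1; 2; 2] m.+1| = 'C(n.-1, n - m.+1).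
Proof.
(* Binomial symmetry reduces the count to [m]-subsets of the [n.-1] positions after the first, the
   places of the new maxima. *)
move=> lt_mn; have -> : n - m.+1 = n.-1 - m by lia.
rewrite bin_sub; last lia.
rewrite -[X in 'C(X, _)]card_ord -card_draws.
pose bits (A : {set 'I_n.-1}) := [seq i \in A | i <- enum 'I_n.-1].
have size_bits A : size (bits A) = n.-1 by rewrite size_map size_enum_ord.
have nth_bits A (i : 'I_n.-1) : nth false (bits A) i = (i \in A).
  by rewrite (nth_map i) ?size_enum_ord // nth_ord_enum.
have count_bits A : count id (bits A) = #|A|.
  by rewrite count_map cardE -size_filter enumT; congr size; apply: eq_filter.
pose f A := record_word 0 (true :: bits A).
apply: (@card_Rmax _ _ _ _ _ f) => [A B _ _ /= []|w].
  move/(record_word_inj 1 isT) => eAB; apply/setP => i.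
  by rewrite -!nth_bits eAB.
split=> [[sz_w w_rgf w_av w_max]|[A]].
  have [|b ew] := (rgf_avoids122 w).1.
    by split=> //; rewrite -size_eq0 sz_w; lia.
  have sz_b : size b = n.-1 by rewrite -sz_w ew size_record_word.
  have eb : bits [set i : 'I_n.-1 | nth false b i] = b.
    apply: (@eq_from_nth _ false); rewrite size_bits // => i lt_i.
    by rewrite (nth_bits _ (Ordinal lt_i)) inE.
  exists [set i : 'I_n.-1 | nth false b i]; last by rewrite /f eb.
  rewrite inE -count_bits eb; apply/eqP.
  by move: w_max; rewrite ew wmax_record_word; lia.
rewrite inE => /eqP cardA ->.
have [w_rgf w_av _] := (rgf_avoids122 _).2 (ex_intro _ (bits A) erefl).
split=> //; first by rewrite size_record_word /= size_bits; lia.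
by rewrite wmax_record_word count_bits cardA.
Qed.

Theorem theorem2p11 (n : nat) (hn : 1 <= n) :
  RB n [:: 1; 1; 2] = LS n [:: 1; 2; 2] /\
  LS n [:: 1; 2; 2] =
    (\sum_(0 <= m < n.+1) 'C(n - 1, n - m)%:R * 'X^('C(m, 2)))%R.
Proof.
have sumE v : (forall m, m < n -> #|Rmax n v m.+1| = 'C(n.-1, n - m.+1)) ->
    (\sum_(0 <= m < n.+1) #|Rmax n v m|%:R * 'X^('C(m, 2)) =
     \sum_(0 <= m < n.+1) 'C(n - 1, n - m)%:R * 'X^('C(m, 2)) :> {poly int})%R.
  (* The term [m = 0] vanishes on both sides; the others are given by [cardE]. *)
  move=> cardE; apply: eq_big_nat => -[|m] /= lt_mn; congr (_%:R * _)%R.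
    by rewrite card_Rmax0 // bin_small; lia.
  by rewrite cardE // subn1.
rewrite {1}/RB /LS !sum_Ravoid.
- by rewrite !sumE // => m; [apply: card_Rmax122 | apply: card_Rmax112].
- move=> t; rewrite !inE => /andP[t_rgf t_av].
  have [|b ->] := (rgf_avoids122 (word t)).1; last first.
    by rewrite wmax_record_word ls_record_word.
  by split=> //; rewrite -size_eq0 size_map size_tuple; lia.
- move=> t; rewrite !inE => /andP[t_rgf t_av].
  have [m [d [bounds_d sorted_d ->]]] := (rgf_avoids112 (word t)).1 (conj t_rgf t_av).
  have le_d : all (fun x => x <= m) d by apply: sub_all bounds_d => a /andP[].
  by rewrite wmax_iota_cat // rb_iota_cat.
Qed.
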